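(* Let $M=\mathbb{R}^2/\mathbb{Z}^2$ be the flat 2-torus with the flat Riemannian metric induced from the Euclidean plane. Then for every point $P\in M$ the wave front $W_t(P)$ becomes dense on $M$. That is, for every $P\in M$ and every $r>0$ there is a time $\tau(P,r)$ such that for all $t>\tau(P,r)$ and all $Q\in M$ one has $W_t(P)\cap B_r(Q)\neq\emptyset$.
   Context: For a point $P$ of a complete Riemannian manifold $M$ and $t>0$, the wave front of $P$ at time $t$ is $W_t(P)=\exp_P(S_t)$, where $\exp_P:T_PM\to M$ is the Riemannian exponential map and $S_t=\{v\in T_PM:\ |v|=t\}$. For the flat torus $M=\mathbb{R}^2/\mathbb{Z}^2$ this is the image under the quotient map $\mathbb{R}^2\to M$ of the Euclidean circle of radius $t$ centered at a lift of $P$. For $Q\in M$ and $r>0$, $B_r(Q)$ is the open ball of points of $M$ that can be joined to $Q$ by a geodesic of length smaller than $r$. The wave front $W_t(P)$ is said to become dense on $M$ if for every open ball $B_r(Q)$ with $r>0$ there is a time $\tau(P,r)$ (depending on $P$ and $r$ but not on $Q$) such that $W_t(P)\cap B_r(Q)\ne\emptyset$ for all $t>\tau(P,r)$; equivalently, for every $\epsilon>0$ the $\epsilon$-neighborhood of $W_t(P)$ is all of $M$ for all sufficiently large $t$. *)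

(* Defs.v *)
From HB Require Import structures.
From mathcomp Require Import all_boot all_order all_algebra.
From mathcomp Require Import ring_quotient archimedean.
From mathcomp Require Import all_classical all_reals.

Set Implicit Arguments.
Unset Strict Implicit.
Unset Printing Implicit Defensive.

Import Order.TTheory GRing.Theory Num.Theory.

Local Open Scope classical_set_scope.
Local Open Scope ring_scope.
Local Open Scope quotient_scope.

Section FlatTorus.
Variable R : realType.

Definition int_lattice : {pred 'rV[R]_2} := fun x => x \is a mxOver Num.int.

Fact int_lattice_zmod_closed : zmod_closed int_lattice.
Proof.
split=> [|x y /mxOverP Zx /mxOverP Zy]; apply/mxOverP => i j; rewrite !mxE.
  exact: rpred0.
exact: rpredB.
Qed.

HB.instance Definition _ :=
  GRing.isZmodClosed.Build 'rV[R]_2 int_lattice int_lattice_zmod_closed.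

(** The quotient group R^2 / Z^2. *)
Definition torus : zmodType := {ideal_quot int_lattice}.

Definition torus_proj (x : 'rV[R]_2) : torus := \pi_{ideal_quot int_lattice} x.

(** The norm [`|v|] of MathComp-Analysis on row vectors is the sup norm, hence
    this explicit Euclidean norm. *)
Definition euclidean_norm (v : 'rV[R]_2) : R :=
  Num.sqrt (\sum_(i < 2) v 0 i ^+ 2).

(** The quotient map is a local isometry for the induced flat metric, so the
    geodesic starting at [P] with initial velocity [v] (tangent spaces being
    identified with R^2) is the image of the straight line through any lift of
    [P] with direction [v]; see [geodesic_proj].  Its speed is constant, equal
    to [euclidean_norm v]. *)
Definition geodesic (P : torus) (v : 'rV[R]_2) (s : R) : torus :=
  P + torus_proj (s *: v).

Lemma geodesic_proj (x v : 'rV[R]_2) (s : R) :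
  geodesic (torus_proj x) v s = torus_proj (x + s *: v).
Proof. by rewrite /geodesic /torus_proj raddfD. Qed.

Definition exp_map (P : torus) (v : 'rV[R]_2) : torus := geodesic P v 1.

Definition tangent_sphere (t : R) : set 'rV[R]_2 :=
  [set v | euclidean_norm v = t].

Definition wave_front (P : torus) (t : R) : set torus :=
  exp_map P @` tangent_sphere t.

(** Points joined to [Q] by a geodesic, parametrized on [0, 1], of length
    smaller than [r]; the length of this arc is [euclidean_norm v]. *)
Definition geodesic_ball (Q : torus) (r : R) : set torus :=
  [set Q' | exists v : 'rV[R]_2,
     geodesic Q v 1 = Q' /\ euclidean_norm v < r].

(** [tau] may depend on [r], but not on the centre [Q]. *)
Definition wave_front_becomes_dense (P : torus) : Prop :=
  forall r : R, 0 < r ->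
    exists tau : R, forall t : R, tau < t ->
      forall Q : torus, wave_front P t `&` geodesic_ball Q r !=set0.

Lemma torus_proj_eq (x y : 'rV[R]_2) :
  torus_proj x = torus_proj y <-> forall i, x 0 i - y 0 i \is a Num.int.
Proof.
have E : (torus_proj x == torus_proj y) = (x - y \in int_lattice).
  by rewrite /torus_proj Quotient.idealrBE.
split=> [/eqP|H].
  by rewrite E => /mxOverP H i; have := H 0 i; rewrite !mxE.
by apply/eqP; rewrite E; apply/mxOverP => i j; rewrite ord1 !mxE.
Qed.

Lemma torus_proj_surj (P : torus) : exists x : 'rV[R]_2, torus_proj x = P.
Proof. by exists (repr P); rewrite /torus_proj reprK. Qed.

End FlatTorus.

(* Main.v *)
Require Import Defs.
From mathcomp Require Import all_boot all_order all_algebra.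
From mathcomp Require Import all_classical all_reals.
From mathcomp Require Import archimedean ring lra.

(** Near its top, the circle of radius [t] is almost horizontal: in the strip
    [t - 1 < y <= t] one has [|x| <= sqrt (2 * t)], so the slope is
    [O(t ^ (-1/2))].  This strip has height 1, so it contains a point of the
    circle with any prescribed ordinate modulo 1; moving along the circle by at
    most 1 horizontally makes the abscissa congruent to any prescribed number
    modulo 1, and changes the ordinate by [O(t ^ (-1/2))] only. *)

Set Implicit Arguments.
Unset Strict Implicit.
Unset Printing Implicit Defensive.

Import Order.TTheory GRing.Theory Num.Theory.

Local Open Scope ring_scope.

Lemma exists_int_translate_near_left {R : archiRealFieldType} (a x : R) :
  exists y, y - a \is a Num.int /\ x - 1 < y <= x.
Proof.
exists (a + (Num.floor (x - a))%:~R); rewrite addrC addKr intr_int; split=> //.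
have := floor_itv (x - a); rewrite intrD => /andP[H1 H2].
by apply/andP; split; lra.
Qed.

(** Meant for [(a, b)] a lift of [Q - P]: then [(x, z)] is another lift, and the circle point
    [(x, y)] lies straight above or below it within [r]. *)
Lemma circle_near_int_translate {R : realType} (r : R) : 0 < r ->
  exists tau : R, forall t : R, tau < t -> forall a b : R,
    exists x y z : R, [/\ x ^+ 2 + y ^+ 2 = t ^+ 2, x - a \is a Num.int,
      z - b \is a Num.int & `|y - z| < r].
Proof.
(* Multiplied by [r], the bound on [t] becomes [rt], exactly what [small] needs once [2 * u] is
   estimated by AM-GM. *)
move=> r0; exists (8 / r ^+ 2 + 2 / r + 2) => t tau_t a b.
have t2 : 2 < t.
  apply: le_lt_trans tau_t; rewrite lerDr addr_ge0 // divr_ge0 //.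
    exact: sqr_ge0.
  exact: ltW.
have rt : 8 / r + 2 + 2 * r < r * t.
  rewrite -ltr_pdivrMl //; apply: le_lt_trans tau_t.
  by rewrite le_eqVlt; apply/orP; left; apply/eqP; field; rewrite gt_eqF.
have [z [zb /andP[tz zt]]] := exists_int_translate_near_left b t.
have zz : 0 <= t ^+ 2 - z ^+ 2 by nra.
pose u := Num.sqrt (t ^+ 2 - z ^+ 2).
have u0 : 0 <= u := sqrtr_ge0 _.
have u2 : u ^+ 2 = t ^+ 2 - z ^+ 2 by rewrite sqr_sqrtr.
have [x [xa /andP[ux xu]]] := exists_int_translate_near_left a u.
have ut : u <= t by rewrite -ler_sqr ?nnegrE //; nra.
(* [x] can be negative only if [u < 1], and then [|x| < 1 < t]. *)
have xx : 0 <= t ^+ 2 - x ^+ 2 by nra.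
pose y := Num.sqrt (t ^+ 2 - x ^+ 2).
have y0 : 0 <= y := sqrtr_ge0 _.
have y2 : y ^+ 2 = t ^+ 2 - x ^+ 2 by rewrite sqr_sqrtr.
exists x, y, z; split => //; first by rewrite y2; lra.
have u2t : u ^+ 2 <= 2 * t by nra.
(* AM-GM: [2 u <= r u^2 / 4 + 4 / r], where [u^2 <= 2 t] *)
have small : 2 * u + 1 < r * (t - 1).
  set s := r^-1 in rt; have rs : r * s = 1 by rewrite mulfV ?gt_eqF.
  have s0 : 0 < s by rewrite invr_gt0.
  have amgm : 2 * u <= r * u ^+ 2 / 4 + 4 * s.
    have : 0 <= r * (u / 2 - 2 * s) ^+ 2 by rewrite mulr_ge0 ?sqr_ge0 // ltW.
    have -> : r * (u / 2 - 2 * s) ^+ 2 =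
        r * u ^+ 2 / 4 - 2 * u * (r * s) + 4 * s * (r * s) by field.
    by rewrite rs; lra.
  have : r * u ^+ 2 <= r * (2 * t) by rewrite ler_pM2l.
  by lra.
(* Both [(u, z)] and [(x, y)] lie on the circle. Dividing by [y + z > t - 1] bounds the vertical
   gap. *)
have yz : (y - z) * (y + z) = (u - x) * (u + x).
  by rewrite -!subr_sqr y2 u2; lra.
have ux2 : `|(u - x) * (u + x)| <= 2 * u + 1 by rewrite ler_norml; nra.
have yzt : t - 1 < y + z by lra.
rewrite -(@ltr_pM2r _ (y + z)); last by lra.
rewrite -[X in `|_| * X]ger0_norm -?normrM ?yz; last by lra.
apply: le_lt_trans ux2 (lt_trans small _).
by rewrite ltr_pM2l.
Qed.

Lemma euclidean_norm2 {R : realType} (v : 'rV[R]_2) :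
  euclidean_norm v = Num.sqrt (v 0 0 ^+ 2 + v 0 1 ^+ 2).
Proof.
rewrite /euclidean_norm big_ord_recl big_ord1.
by congr (Num.sqrt (_ + v _ _ ^+ 2)); apply: val_inj.
Qed.

Theorem theorem1 (R : realType) (P : torus R) : wave_front_becomes_dense P.
Proof.
move=> r r0; have [tau circle] := circle_near_int_translate r0.
(* The maximum with 0 gives [0 < t], so the square root of [t ^+ 2] is [t]. *)
exists (Num.max tau 0) => t; rewrite gt_max => /andP[tau_t t0] Q.
have [p <-] := torus_proj_surj P; have [q <-] := torus_proj_surj Q.
have [x [y [z [xy xa zb yz]]]] :=
  circle t tau_t (q 0 0 - p 0 0) (q 0 1 - p 0 1).
(* [p + v] and [q + w] differ by the integer vector [(x - a, z - b)], where [(a, b) = q - p]. *)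
pose v : 'rV[R]_2 := \row_i (if i == 0 then x else y).
pose w : 'rV[R]_2 := \row_i (if i == 0 then 0 else y - z).
exists (geodesic (torus_proj p) v 1); split.
  exists v => //; rewrite /tangent_sphere /= euclidean_norm2 !mxE /= xy.
  by rewrite sqrtr_sqr gtr0_norm.
exists w; split; last first.
  by rewrite euclidean_norm2 !mxE /= expr0n add0r sqrtr_sqr.
rewrite !geodesic_proj; apply/torus_proj_eq => i.
rewrite -rpredN !mxE !mul1r; case: ifPn => [/eqP ->|i0].
  by congr (_ \is a Num.int): xa; lra.
have -> : i = 1 by apply: val_inj; case: i i0 => [[|[|]]].
by congr (_ \is a Num.int): zb; lra.
Qed.
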